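(* Let $\mathbf P$ be a finite set with partial order $<$, let $\Delta:\bigoplus_{p\in\mathbf P}C(p)\to\bigoplus_{p\in\mathbf P}C(p)$ be a connection matrix of a graded module braid $\mathcal G$ over $<$ with associated graded module braid isomorphism $\Phi:\mathcal H\Delta\to\mathcal G$, let $\Delta':\bigoplus_{p\in\mathbf P}C'(p)\to\bigoplus_{p\in\mathbf P}C'(p)$ be a connection matrix, and let $T:\bigoplus_{p\in\mathbf P}C(p)\to\bigoplus_{p\in\mathbf P}C'(p)$ be an algebraic transition matrix from $\Delta$ to $\Delta'$, i.e. $T$ is $<$-upper triangular, $T(p)=T(\{p\})$ is an isomorphism for every $p\in\mathbf P$, and $\Delta'T=T\Delta$. Then the maps $\Phi'(\mathbf I)=\Phi(\mathbf I)\circ T_*(\mathbf I)^{-1}$, for intervals $\mathbf I$, where $T_*(\mathbf I)$ is the (iso)morphism induced by $T(\mathbf I)$ on homology, define a graded module braid isomorphism $\Phi':\mathcal H\Delta'\to\mathcal G$, and $T$ covers $\mathrm{id}:\mathcal G\to\mathcal G$ relative to $\Phi$ and $\Phi'$; hence $T$ is a transition matrix.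
   Context: Intervals. $\mathbf P$ is a finite set with a (strict) partial order $<$. An interval is a subset $\mathbf I\subseteq\mathbf P$ such that $p,q\in\mathbf I$ and $p<r<q$ imply $r\in\mathbf I$; $\mathbf I(<)$ is the set of intervals. An adjacent $n$-tuple of intervals is an ordered collection $(\mathbf I_1,\dots,\mathbf I_n)$ of mutually disjoint nonempty intervals whose union is an interval and such that $\pi\in\mathbf I_j$, $\pi'\in\mathbf I_k$, $j<k$ imply $\pi'\not<\pi$; $\mathbf I_n(<)$ is the set of these. For $(\mathbf I,\mathbf J)\in\mathbf I_2(<)$ write $\mathbf{IJ}=\mathbf I\cup\mathbf J$. Disjoint $\mathbf I,\mathbf J$ are noncomparable if no element of $\mathbf I$ is comparable to an element of $\mathbf J$. Graded module braids. A graded module braid $\mathcal G$ over $<$ consists of a graded module $G(\mathbf I)$ for each $\mathbf I\in\mathbf I(<)$ and, for each $(\mathbf I,\mathbf J)\in\mathbf I_2(<)$, maps $i(\mathbf I,\mathbf{IJ}):G(\mathbf I)\to G(\mathbf{IJ})$ and $p(\mathbf{IJ},\mathbf J):G(\mathbf{IJ})\to G(\mathbf J)$ of degree $0$ and $\partial(\mathbf J,\mathbf I):G(\mathbf J)\to G(\mathbf I)$ lowering degree by $1$, such that $\cdots\to G(\mathbf I)\xrightarrow{i}G(\mathbf{IJ})\xrightarrow{p}G(\mathbf J)\xrightarrow{\partial}G(\mathbf I)\to\cdots$ is exact; $p(\mathbf{JI},\mathbf I)\,i(\mathbf I,\mathbf{IJ})=\mathrm{id}$ if $\mathbf I,\mathbf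 J$ are noncomparable; and for $(\mathbf I,\mathbf J,\mathbf K)\in\mathbf I_3(<)$ the standard braid diagram formed by the four long exact sequences of $(\mathbf I,\mathbf J)$, $(\mathbf J,\mathbf K)$, $(\mathbf I,\mathbf{JK})$, $(\mathbf{IJ},\mathbf K)$ commutes. A map $\theta:\mathcal G\to\mathcal G'$ is a collection of degree-$0$ homomorphisms $\theta(\mathbf I):G(\mathbf I)\to G'(\mathbf I)$ commuting with all $i,p,\partial$; it is an isomorphism if every $\theta(\mathbf I)$ is. Matrices. A map $T:\bigoplus C(p)\to\bigoplus C'(p)$ is a matrix with entries $T(p,q):C(q)\to C'(p)$; $T(\mathbf I)$ is the submatrix with indices in $\mathbf I$. $T$ is $<$-upper triangular if $T(p,q)\neq0$ implies $p=q$ or $p<q$. A $<$-upper triangular boundary map $\Delta$ on $\bigoplus C(p)$ (degree $-1$, $\Delta^2=0$) generates a chain complex braid $\mathcal C\Delta=\{(C(\mathbf I),\Delta(\mathbf I))\}$, $C(\mathbf I)=\bigoplus_{p\in\mathbf I}C(p)$, with the obvious inclusions $i$ and projections $p$; its homology is a graded module braid $\mathcal H\Delta$. $\Delta$ is a connection matrix of $\mathcal G$ if $\mathcal H\Delta$ is isomorphic to $\mathcal G$ and $C(p)\cong G(\{p\})$ for each $p$. Transition matrices between chain modules are of degree $0$ here. Transition matrices. A matrix $T:\bigoplus C(p)\to\bigoplus C'(p)$ is a ($0$-degree) transition matrix for connection matrices $\Delta$ of $\mathcal G$ and $\Delta'$ of $\mathcal G'$ if the collection $\{T(\mathbf I)\}_{\mathbf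 I\in\mathbf I(<)}$ consists of degree-$0$ chain maps $\mathcal C\Delta(\mathbf I)\to\mathcal C\Delta'(\mathbf I)$ commuting with all $i$ and $p$, and covers some isomorphism $\theta:\mathcal G\to\mathcal G'$ relative to some graded module braid isomorphisms $\Phi:\mathcal H\Delta\to\mathcal G$, $\Phi':\mathcal H\Delta'\to\mathcal G'$, meaning $\Phi'(\mathbf I)\circ T_*(\mathbf I)=\theta(\mathbf I)\circ\Phi(\mathbf I)$ for all $\mathbf I\in\mathbf I(<)$. *)

(* Defs.v *)
From HB Require Import structures.
From mathcomp Require Import all_boot all_order all_algebra.
From mathcomp Require Import boolp.

Set Implicit Arguments.
Unset Strict Implicit.
Unset Printing Implicit Defensive.

Import Order.TTheory GRing.Theory.
Local Open Scope ring_scope.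
Local Open Scope quotient_scope.

Section Kernel.
Variables (R : pzRingType) (V W : lmodType R) (f : {linear V -> W}).

Definition in_ker (x : V) : bool := f x == 0.

Fact in_ker_submod : submod_closed in_ker.
Proof.
split=> [|a x y]; rewrite !unfold_in /in_ker ?linear0 // => /eqP fx /eqP fy.
by rewrite linearP fx fy scaler0 addr0.
Qed.
HB.instance Definition _ := GRing.isSubmodClosed.Build R V in_ker in_ker_submod.

Record ker := Ker { ker_val : V; _ : in_ker ker_val }.
HB.instance Definition _ := [isSub for ker_val].
HB.instance Definition _ := [Choice of ker by <:].
HB.instance Definition _ := [SubChoice_isSubLmodule of ker by <:].

Lemma kerP (x : ker) : f (val x) = 0.
Proof. by case: x => x /= /eqP. Qed.
End Kernel.

Section Homology.
Variables (R : pzRingType) (U V W : lmodType R).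
Variables (g : {linear U -> V}) (f : {linear V -> W}).

(* ker f / im g.  No relation between f and g is assumed here: in_bdry is the
   preimage of im g in ker f.  It is only used below when f \o g = 0. *)
Definition in_bdry (x : ker f) : bool := `[< exists y, val x = g y >].

Fact in_bdry_submod : submod_closed in_bdry.
Proof.
split=> [|a x y]; rewrite !unfold_in /in_bdry.
  by apply/asboolP; exists 0; rewrite !linear0.
move=> /asboolP[u xu] /asboolP[v yv]; apply/asboolP; exists (a *: u + v).
by rewrite linearP -xu -yv linearP.
Qed.
HB.instance Definition _ :=
  GRing.isSubmodClosed.Build R (ker f) in_bdry in_bdry_submod.

Definition homology := Quotient.quot (GRing.ZmodClosed.clone (ker f) in_bdry _).
HB.instance Definition _ := GRing.Zmodule.on homology.
HB.instance Definition _ := EqQuotient.on homology.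

Definition hclass (x : ker f) : homology := \pi_homology x.

Lemma hclass_eq x y : hclass x = hclass y <-> exists z, val x - val y = g z.
Proof.
rewrite /hclass; split.
  by move/eqP; rewrite -Quotient.idealrBE => /asboolP; rewrite linearB.
by move=> xy; apply/eqP; rewrite -Quotient.idealrBE; apply/asboolP; rewrite linearB.
Qed.

Lemma hclass_surj u : exists x, u = hclass x.
Proof. by exists (repr u); rewrite /hclass reprK. Qed.

Fact hclassB : {morph hclass : x y / x - y}.
Proof. by move=> x y; rewrite /hclass !piE. Qed.

Lemma hclassD : {morph hclass : x y / x + y}.
Proof. by move=> x y; rewrite /hclass !piE. Qed.

Definition hscale (a : R) (u : homology) : homology := hclass (a *: repr u).

Lemma hscaleE a x : hscale a (hclass x) = hclass (a *: x).
Proof.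
apply/hclass_eq.
have /hclass_eq[z xz] : hclass (repr (hclass x)) = hclass x.
  by rewrite /hclass reprK.
by exists (a *: z); rewrite [RHS]linearZ -xz -!linearB -scalerBr [LHS]linearZ.
Qed.

Fact hscaleA a b u : hscale a (hscale b u) = hscale (a * b) u.
Proof. by have [x ->] := hclass_surj u; rewrite !hscaleE scalerA. Qed.
Fact hscale1 : left_id 1 hscale.
Proof. by move=> u; have [x ->] := hclass_surj u; rewrite hscaleE scale1r. Qed.
Fact hscaleDr : right_distributive hscale +%R.
Proof.
move=> a u v; have [x ->] := hclass_surj u; have [y ->] := hclass_surj v.
by rewrite -hclassD !hscaleE -hclassD scalerDr.
Qed.
Fact hscaleDl v : {morph hscale^~ v : a b / a + b}.
Proof.
move=> a b /=; have [x ->] := hclass_surj v.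
by rewrite !hscaleE -hclassD scalerDl.
Qed.
HB.instance Definition _ := GRing.Zmodule_isLmodule.Build R homology
  hscaleA hscale1 hscaleDr hscaleDl.

Fact hclassZ : scalable hclass.
Proof. by move=> a x; rewrite -hscaleE. Qed.
HB.instance Definition _ := GRing.isZmodMorphism.Build _ _ hclass hclassB.
HB.instance Definition _ := GRing.isScalable.Build R _ _ _ hclass hclassZ.
End Homology.

(* The map induced on homology by a linear map k that preserves kernels and
   images; k need not be part of a chain map of degree 0, so this also yields
   connecting homomorphisms. *)
Section HomologyMap.
Variables (R : pzRingType) (U V W U' V' W' : lmodType R).
Variables (g : {linear U -> V}) (f : {linear V -> W}).
Variables (g' : {linear U' -> V'}) (f' : {linear V' -> W'}).
Variable k : {linear V -> V'}.
Hypothesis kZ : forall x, f x = 0 -> f' (k x) = 0.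
Hypothesis kB : forall y, exists y', k (g y) = g' y'.

Fact kerm_subproof (x : ker f) : in_ker f' (k (val x)).
Proof. by apply/eqP/kZ/kerP. Qed.
Definition kerm (x : ker f) : ker f' := Ker (kerm_subproof x).

Definition hmap_fun (u : homology g f) : homology g' f' :=
  hclass g' (kerm (repr u)).

Fact hmap_funE x : hmap_fun (hclass g x) = hclass g' (kerm x).
Proof.
have /hclass_eq[z xz] : hclass g (repr (hclass g x)) = hclass g x.
  by rewrite /hclass reprK.
apply/hclass_eq; have [z' kz] := kB z; exists z'.
by rewrite /= -linearB xz.
Qed.

Fact hmap_linear : linear hmap_fun.
Proof.
move=> a u v; have [x ->] := hclass_surj u; have [y ->] := hclass_surj v.
rewrite -linearP !hmap_funE -linearP; congr hclass; apply: val_inj.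
by rewrite /= linearP.
Qed.
HB.instance Definition _ :=
  GRing.isLinear.Build R _ _ _ hmap_fun hmap_linear.

Definition hmap : {linear homology g f -> homology g' f'} := hmap_fun.

Lemma hmapE x : hmap (hclass g x) = hclass g' (kerm x).
Proof. exact: hmap_funE. Qed.
End HomologyMap.

Section DirectSum.
Variables (R : pzRingType) (P : finType).
Implicit Types (A B : {set P}) (V : P -> lmodType R).

(* The direct sum of the modules V p over p in A: P is finite, so it is the
   product. *)
Definition dsum A V := {dffun forall p : {p : P | p \in A}, V (val p)}.

Section Module.
Variables (A : {set P}) (V : P -> lmodType R).
Implicit Types x y z : dsum A V.

HB.instance Definition _ := Choice.on (dsum A V).

Definition dsum_zero : dsum A V := [ffun p => 0].
Definition dsum_opp x : dsum A V := [ffun p => - x p].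
Definition dsum_add x y : dsum A V := [ffun p => x p + y p].
Definition dsum_scale (a : R) x : dsum A V := [ffun p => a *: x p].

Fact dsum_addA : associative dsum_add.
Proof. by move=> x y z; apply/ffunP=> p; rewrite !ffunE addrA. Qed.
Fact dsum_addC : commutative dsum_add.
Proof. by move=> x y; apply/ffunP=> p; rewrite !ffunE addrC. Qed.
Fact dsum_add0 : left_id dsum_zero dsum_add.
Proof. by move=> x; apply/ffunP=> p; rewrite !ffunE add0r. Qed.
Fact dsum_addN : left_inverse dsum_zero dsum_opp dsum_add.
Proof. by move=> x; apply/ffunP=> p; rewrite !ffunE addNr. Qed.
HB.instance Definition _ :=
  GRing.isZmodule.Build (dsum A V) dsum_addA dsum_addC dsum_add0 dsum_addN.

Fact dsum_scaleA a b x : dsum_scale a (dsum_scale b x) = dsum_scale (a * b) x.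
Proof. by apply/ffunP=> p; rewrite !ffunE scalerA. Qed.
Fact dsum_scale1 : left_id 1 dsum_scale.
Proof. by move=> x; apply/ffunP=> p; rewrite !ffunE scale1r. Qed.
Fact dsum_scaleDr : right_distributive dsum_scale +%R.
Proof. by move=> a x y; apply/ffunP=> p; rewrite !ffunE scalerDr. Qed.
Fact dsum_scaleDl x : {morph dsum_scale^~ x : a b / a + b}.
Proof. by move=> a b; apply/ffunP=> p; rewrite !ffunE scalerDl. Qed.
HB.instance Definition _ := GRing.Zmodule_isLmodule.Build R (dsum A V)
  dsum_scaleA dsum_scale1 dsum_scaleDr dsum_scaleDl.

(* The p-th component of x, read as 0 outside A. *)
Definition coord x (p : P) : V p :=
  if decP (@idP (p \in A)) is left pA then x (exist _ p pA) else 0.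

Lemma coord_val x (p : {p : P | p \in A}) : coord x (val p) = x p.
Proof.
case: p => p pA /=; rewrite /coord; case: decP => // pA'.
by congr (x (exist _ p _)); apply: bool_irrelevance.
Qed.

Lemma coord_out x p : p \notin A -> coord x p = 0.
Proof. by rewrite /coord => /negP; case: decP. Qed.

Lemma coordP x y : (forall p, p \in A -> coord x p = coord y p) -> x = y.
Proof. by move=> xy; apply/ffunP=> p; rewrite -!coord_val xy ?(valP p). Qed.

Lemma coord_ffun (F : forall p, V p) p :
  p \in A -> coord [ffun q => F (val q)] p = F p.
Proof. by rewrite /coord; case: decP => // pA _; rewrite ffunE. Qed.

Fact coord_linear p : linear (coord^~ p).
Proof.
move=> a x y; rewrite /coord; case: decP => pA; first by rewrite !ffunE.
by rewrite scaler0 addr0.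
Qed.
Lemma coord0 p : coord 0 p = 0.
Proof. by have := coord_linear p (-1) 0 0; rewrite scaleN1r oppr0 addr0 scaleN1r addNr. Qed.
Lemma coordD x y p : coord (x + y) p = coord x p + coord y p.
Proof. by have := coord_linear p 1 x y; rewrite !scale1r. Qed.
Lemma coordN x p : coord (- x) p = - coord x p.
Proof. by have := coord_linear p (-1) x 0; rewrite !scaleN1r coord0 !addr0. Qed.
End Module.

(* The inclusion when A \subset B, the projection when B \subset A. *)
Section Transfer.
Variables (A B : {set P}) (V : P -> lmodType R).
Definition transfer_fun (x : dsum A V) : dsum B V :=
  [ffun p => coord x (val p)].
Fact transfer_linear : linear transfer_fun.
Proof. by move=> a x y; apply/ffunP => p; rewrite !ffunE coord_linear. Qed.
HB.instance Definition _ :=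
  GRing.isLinear.Build R _ _ _ transfer_fun transfer_linear.
Definition transfer : {linear dsum A V -> dsum B V} := transfer_fun.
Lemma coord_transfer x p : coord (transfer x) p = if p \in B then coord x p else 0.
Proof.
case: ifPn => pB; last exact: coord_out.
exact: (coord_ffun (coord x)).
Qed.
End Transfer.

(* The submatrix with rows A and columns B of a matrix of linear maps. *)
Section Submatrix.
Variables (V W : P -> lmodType R).
Variable M : forall p q, {linear V q -> W p}.
Variables (A B : {set P}).
Definition block_fun (x : dsum B V) : dsum A W :=
  [ffun p => \sum_q M (val p) (val q) (x q)].
Fact block_linear : linear block_fun.
Proof.
move=> a x y; apply/ffunP=> p; rewrite !ffunE scaler_sumr -big_split /=.
by apply: eq_bigr => q _; rewrite !ffunE linearP.
Qed.
HB.instance Definition _ :=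
  GRing.isLinear.Build R _ _ _ block_fun block_linear.
Definition block : {linear dsum B V -> dsum A W} := block_fun.
Lemma coord_block x p : 
  coord (block x) p = if p \in A then \sum_(q in B) M p q (coord x q) else 0.
Proof.
case: ifPn => pA; last exact: coord_out.
rewrite (_ : block x = [ffun p => \sum_(q in B) M (val p) q (coord x q)]).
  exact: (coord_ffun (fun p => \sum_(q in B) M p q (coord x q))).
apply/ffunP=> r; rewrite !ffunE [RHS]big_sub; apply: eq_bigr => q _.
by rewrite coord_val.
Qed.
End Submatrix.
End DirectSum.

Section Graded.
Variable R : pzRingType.

(* Graded modules are Z-graded left R-modules. *)
Definition gmod := int -> lmodType R.
Definition ghom0 (A B : gmod) := forall n, {linear A n -> B n}.
(* A map lowering degree by 1 is indexed by its source and target degrees m, n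
   with a proof that m = n + 1, which avoids transporting along equalities in
   int; such proofs are unique. *)
Definition ghom1 (A B : gmod) :=
  forall m n : int, m = n + 1 -> {linear A m -> B n}.

Definition gcomp (A B C : gmod) (g : ghom0 B C) (f : ghom0 A B) : ghom0 A C :=
  fun n => g n \o f n.
Definition gid (A : gmod) : ghom0 A A := fun n => idfun.
Definition giso (A B : gmod) := exists f : ghom0 A B, forall n, bijective (f n).

Record complex := Complex {
  cmod : gmod;
  cdiff : ghom1 cmod cmod;
  cdiffK : forall (l m n : int) (e1 : l = m + 1) (e2 : m = n + 1) x,
    cdiff e2 (cdiff e1 x) = 0
}.
Arguments cdiff c {m n} e.

Definition is_chain_map (C D : complex) (f : ghom0 (cmod C) (cmod D)) :=
  forall (m n : int) (e : m = n + 1) x,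
    f n (cdiff C e x) = cdiff D e (f m x).

Definition predK (n : int) : n = n - 1 + 1 := esym (subrK 1 n).

(* Homology in degree n: the kernel of C n -> C (n - 1) modulo the image of
   C (n + 1) -> C n. *)
Definition ghomology (C : complex) : gmod := fun n =>
  homology (cdiff C (erefl (n + 1))) (cdiff C (predK n)).

Definition hcl (C : complex) n (x : ker (cdiff C (predK n))) : ghomology C n :=
  hclass (cdiff C (erefl (n + 1))) x.

Lemma cdiff_ker (C : complex) n (x : cmod C n) :
  cdiff C (predK n) x = 0 -> forall m (e : n = m + 1), cdiff C e x = 0.
Proof.
move=> dx m e; have em : m = n - 1 by rewrite e addrK.
by subst m; rewrite (eq_irrelevance e (predK n)).
Qed.

Lemma hcl_ker (C : complex) n (x : ker (cdiff C (predK n))) m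
  (e : n = m + 1) : cdiff C e (val x) = 0.
Proof. by apply: cdiff_ker; apply: kerP. Qed.

Section ChainMap.
Variables (C D : complex) (f : ghom0 (cmod C) (cmod D)) (hf : is_chain_map f) (n : int).
Fact chain_map_ker x : cdiff C (predK n) x = 0 -> cdiff D (predK n) (f n x) = 0.
Proof. by move=> dx; rewrite -hf dx linear0. Qed.
Fact chain_map_bdry (y : cmod C (n + 1)) :
  exists y', f n (cdiff C (erefl (n + 1)) y) = cdiff D (erefl (n + 1)) y'.
Proof. by exists (f _ y); rewrite hf. Qed.
End ChainMap.

Definition ghomology_map (C D : complex) (f : ghom0 (cmod C) (cmod D)) (hf : is_chain_map f) :
    ghom0 (ghomology C) (ghomology D) :=
  fun n => hmap (chain_map_ker hf (n:=n)) (chain_map_bdry hf (n:=n)).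
End Graded.

Section Intervals.
Variables (d : Order.disp_t) (P : finPOrderType d).

Definition is_interval (I : {set P}) : bool :=
  [forall p in I, forall q in I, forall r, (p < r < q)%O ==> (r \in I)].

Record interval := Interval { iset :> {set P}; iset_interval : is_interval iset }.

(* Adjacent (size s)-tuples: the last clause says that q < p fails whenever p
   lies in an earlier member of s than q. *)
Definition adjacent (s : seq {set P}) : bool :=
  [&& all is_interval s, all (fun I => I != set0) s,
      pairwise (fun I J : {set P} => [disjoint I & J]) s,
      is_interval (\bigcup_(I <- s) I)
    & pairwise (fun I J : {set P} =>
        [forall p in I, forall q in J, ~~ (q < p)%O]) s].

(* (I, J) is an adjacent pair and L = IJ. *)
Definition adj (I J L : interval) : bool :=
  adjacent [:: iset I; iset J] && (iset L == iset I :|: iset J).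

Definition noncomparable (I J : {set P}) : bool :=
  [forall p in I, forall q in J, ~~ (p < q)%O && ~~ (q < p)%O].

Fact is_interval1 (p : P) : is_interval [set p].
Proof.
apply/forall_inP => a /set1P ->; apply/forall_inP => b /set1P ->.
by apply/forallP => r; apply/implyP => /andP[/lt_trans h /h]; rewrite ltxx.
Qed.
Definition interval1 (p : P) : interval := Interval (is_interval1 p).

Lemma intervalP (L : interval) p q r :
  p \in iset L -> q \in iset L -> (p < r)%O -> (r < q)%O -> r \in iset L.
Proof.
case: L => L /= /forall_inP hL /hL /forall_inP h /h /forallP hr pr rq.
by move: (hr r); rewrite pr rq.
Qed.

Lemma adjP (I J L : interval) : adj I J L ->
  [/\ iset L = iset I :|: iset J, [disjoint iset I & iset J]
    & forall p q, p \in iset I -> q \in iset J -> (q < p)%O = false].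
Proof.
case/andP=> /and5P[_ _ dis _ ord] /eqP ->; split=> //.
  by move: dis; rewrite /= !andbT.
move: ord; rewrite /= !andbT => /forall_inP h p q /h /forall_inP hp /hp.
by move/negbTE.
Qed.
End Intervals.

Section Braids.
Variables (R : pzRingType) (d : Order.disp_t) (P : finPOrderType d).

(* For h : adj I J L, that is L = IJ: bi h is i(I, IJ), bp h is p(IJ, J) and
   bd h is the connecting map d(J, I). *)
Record braid_data := BraidData {
  bmod : interval P -> gmod R;
  bi : forall I J L, adj I J L -> ghom0 (bmod I) (bmod L);
  bp : forall I J L, adj I J L -> ghom0 (bmod L) (bmod J);
  bd : forall I J L, adj I J L -> ghom1 (bmod J) (bmod I)
}.

Definition exact (A B C : lmodType R) (f : {linear A -> B})
    (g : {linear B -> C}) :=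
  forall y, g y = 0 <-> exists x, y = f x.

Record is_braid (G : braid_data) : Prop := IsBraid {
  braid_exact : forall I J L (h : adj I J L) (m n : int) (e : m = n + 1),
    [/\ exact (bi G h n) (bp G h n), exact (bp G h m) (bd G h e)
      & exact (bd G h e) (bi G h n)];
  braid_noncomparable : forall I J L (h : adj I J L) (h' : adj J I L),
    noncomparable I J -> forall n x, bp G h' n (bi G h n x) = x;
  (* The triangles and squares of the braid diagram of the sequences of (I, J),
     (J, K), (I, JK) and (IJ, K).  IJ, JK and L = IJK are always intervals when
     (I, J, K) is adjacent. *)
  braid_comm : forall (I J K IJ JK L : interval P), adjacent [:: iset I; iset J; iset K] ->
    forall (hIJ : adj I J IJ) (hJK : adj J K JK)
      (hI_JK : adj I JK L) (hIJ_K : adj IJ K L),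
    (forall n x, bi G hIJ_K n (bi G hIJ n x) = bi G hI_JK n x) /\
    (forall n x, bp G hJK n (bp G hI_JK n x) = bp G hIJ_K n x) /\
    (forall n x, bp G hI_JK n (bi G hIJ_K n x) = bi G hJK n (bp G hIJ n x)) /\
    (forall (m n : int) (e : m = n + 1) x,
       bd G hI_JK e (bi G hJK m x) = bd G hIJ e x) /\
    (forall (m n : int) (e : m = n + 1) x,
       bp G hIJ n (bd G hIJ_K e x) = bd G hJK e x) /\
    (forall (m n : int) (e : m = n + 1) x,
       bi G hIJ n (bd G hI_JK e x) = bd G hIJ_K e (bp G hJK m x))
}.

Record braid := Braid { bdata :> braid_data; _ : is_braid bdata }.

Definition bhom (G G' : braid) := forall I, ghom0 (bmod G I) (bmod G' I).
Definition bid (G : braid) : bhom G G := fun I => gid (bmod G I).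

Definition is_braid_map (G G' : braid) (theta : bhom G G') : Prop :=
  forall I J L (h : adj I J L),
  [/\ forall n x, theta L n (bi G h n x) = bi G' h n (theta I n x),
      forall n x, theta J n (bp G h n x) = bp G' h n (theta L n x)
    & forall (m n : int) (e : m = n + 1) x,
        theta I n (bd G h e x) = bd G' h e (theta J m x)].

Definition is_braid_iso (G G' : braid) (theta : bhom G G') : Prop :=
  is_braid_map theta /\ forall I n, bijective (theta I n).
End Braids.

Section Matrices.
Variables (R : pzRingType) (d : Order.disp_t) (P : finPOrderType d).
Implicit Types C : P -> gmod R.

Definition gsum (A : {set P}) C : gmod R := fun n => dsum A (fun p => C p n).

(* Matrices of maps of degree 0 and -1; the (p, q) entry maps C q to C' p. *)
Definition mat0 C C' := forall p q, ghom0 (C q) (C' p).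
Definition mat1 C C' := forall p q, ghom1 (C q) (C' p).

Definition block0 C C' (T : mat0 C C') (A B : {set P}) :
    ghom0 (gsum B C) (gsum A C') :=
  fun n => block (fun p q => T p q n) A B.
Definition block1 C C' (D : mat1 C C') (A B : {set P}) :
    ghom1 (gsum B C) (gsum A C') :=
  fun m n e => block (fun p q => D p q m n e) A B.

Definition upper0 C C' (T : mat0 C C') := forall p q n (x : C q n),
  T p q n x != 0 -> p = q \/ (p < q)%O.
Definition upper1 C C' (D : mat1 C C') := forall p q (m n : int) (e : m = n + 1) x,
  D p q m n e x != 0 -> p = q \/ (p < q)%O.

(* <-upper triangular boundary maps; bmat_sq is the matrix product
   Delta * Delta = 0, entry by entry. *)
Record boundary C := Boundary {
  bmat : mat1 C C;
  bmat_upper : upper1 bmat;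
  bmat_sq : forall p q (l m n : int) (e1 : l = m + 1) (e2 : m = n + 1) x,
    \sum_r bmat p r e2 (bmat r q e1 x) = 0
}.

(* The obvious inclusions and projections between the C(I). *)
Definition gtransfer C (A B : {set P}) : ghom0 (gsum A C) (gsum B C) :=
  fun n => transfer A B (fun p => C p n).

End Matrices.

Arguments block1 : simpl never.
Arguments block0 : simpl never.
Arguments gtransfer : simpl never.

Section BlockTheory.
Variables (R : pzRingType) (d : Order.disp_t) (P : finPOrderType d).
Variables (C : P -> gmod R) (D : boundary C).
Implicit Types A B I J L : {set P}.
Local Notation blk := (block1 (bmat D)).
Local Notation tr := (@gtransfer R d P C).

Lemma coord_tr A B n (x : gsum A C n) p :
  coord (tr A B n x) p = if p \in B then coord x p else 0.
Proof. exact: coord_transfer. Qed.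

Lemma coord_blk A B (m n : int) (e : m = n + 1) (x : gsum B C m) p :
  coord (blk A B e x) p =
    if p \in A then \sum_(q in B) bmat D p q e (coord x q) else 0.
Proof. exact: (coord_block (fun p q => bmat D p q e)). Qed.

Lemma trtr A B B' n (x : gsum A C n) : A :&: B' \subset B ->
  tr B B' n (tr A B n x) = tr A B' n x.
Proof.
move=> /subsetP sub; apply: coordP => p pB'; rewrite !coord_tr pB'.
case: ifPn => // pB; rewrite coord_out //; apply: contra pB => pA.
by apply: sub; rewrite inE pA.
Qed.

Lemma trid A n (x : gsum A C n) : tr A A n x = x.
Proof. by apply: coordP => p pA; rewrite coord_tr pA. Qed.

Lemma tr0 A B n (x : gsum A C n) : [disjoint A & B] -> tr A B n x = 0.
Proof.
move=> dis; apply: coordP => p pB; rewrite coord_tr pB coord0 coord_out //.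
by rewrite (disjointFl dis pB).
Qed.

Lemma tr_split I J n (x : gsum (I :|: J) C n) : [disjoint I & J] ->
  x = tr I (I :|: J) n (tr (I :|: J) I n x) + tr J (I :|: J) n (tr (I :|: J) J n x).
Proof.
move=> dis; apply: coordP => p pIJ; rewrite coordD !coord_tr pIJ.
move: pIJ; rewrite inE; case: (boolP (p \in I)) => pI /= pJ.
  by rewrite (disjointFr dis pI) addr0.
by rewrite pJ add0r.
Qed.

Section Deg.
Variables (m n : int) (e : m = n + 1).

Lemma tr_blk A B B' x : B \subset B' ->
  tr B' B n (blk B' A e x) = blk B A e x.
Proof.
move=> /subsetP sub; apply: coordP => p pB.
by rewrite coord_tr !coord_blk pB sub.
Qed.

Lemma blk_tr A A' B x : A \subset A' ->
  blk B A' e (tr A A' m x) = blk B A e x.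
Proof.
move=> /subsetP sub; apply: coordP => p pB; rewrite !coord_blk pB.
rewrite [RHS]big_mkcond [LHS]big_mkcond; apply: eq_bigr => q _.
rewrite coord_tr; case: (boolP (q \in A)) => qA; first by rewrite sub.
by rewrite (coord_out x qA) if_same linear0 if_same.
Qed.

Lemma blk_split B I J x : [disjoint I & J] ->
  blk B (I :|: J) e x =
    blk B I e (tr _ I m x) + blk B J e (tr _ J m x).
Proof.
move=> dis; rewrite {1}[x](tr_split _ dis) linearD.
by congr (_ + _); apply: blk_tr; rewrite ?subsetUl ?subsetUr.
Qed.

Lemma blk_tri I J x : [disjoint I & J] ->
  (forall p q, p \in I -> q \in J -> (q < p)%O = false) ->
  blk J I e x = 0.
Proof.
move=> dis ord; apply: coordP => p pJ; rewrite coord_blk pJ coord0.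
rewrite big1 // => q qI; apply/eqP; apply/negPn/negP => /bmat_upper[pq|].
  by move: pJ; rewrite pq (disjointFr dis qI).
by rewrite ord.
Qed.
End Deg.

Lemma blk_sq (L : interval P) A B (l m n : int) (e1 : l = m + 1) (e2 : m = n + 1) x :
  A \subset iset L -> B \subset iset L ->
  blk A (iset L) e2 (blk (iset L) B e1 x) = 0.
Proof.
move=> /subsetP AL /subsetP BL; apply: coordP => p pA; rewrite coord_blk pA coord0.
under eq_bigr => r rL do rewrite coord_blk rL linear_sum /=.
rewrite exchange_big big1 // => q qB.
rewrite -[RHS](bmat_sq D p e1 e2 (coord x q)) big_mkcond.
apply: eq_bigr => r _; case: ifPn => // rL; apply/esym/eqP/negPn/negP => nz.
case: (bmat_upper nz) => [pr|pr].
  by move: rL; rewrite -pr AL.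
have [|rq|rq] := @bmat_upper _ _ _ _ D r q l m e1 (coord x q).
- by apply: contraNneq nz => ->; rewrite linear0.
- by move: rL; rewrite rq BL.
- by move: rL; rewrite (intervalP (AL _ pA) (BL _ qB) pr rq).
Qed.

Lemma blk_sq_diag (L : interval P) (l m n : int) (e1 : l = m + 1) (e2 : m = n + 1) x :
  blk (iset L) (iset L) e2 (blk (iset L) (iset L) e1 x) = 0.
Proof. exact: blk_sq. Qed.
End BlockTheory.

Section HomologyBraid.
Variables (R : pzRingType) (d : Order.disp_t) (P : finPOrderType d).
Variables (C : P -> gmod R) (D : boundary C).
Local Notation blk := (block1 (bmat D)).
Local Notation tr := (@gtransfer R d P C).

(* C Delta(I) = (C(I), Delta(I)). *)
Definition cbraid (I : interval P) : complex R :=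
  Complex (@blk_sq_diag R d P C D I).

Section Adjacent.
Variables (I J L : interval P) (h : adj I J L).

Let subI : iset I \subset iset L.
Proof. by have [-> _ _] := adjP h; apply: subsetUl. Qed.
Let subJ : iset J \subset iset L.
Proof. by have [-> _ _] := adjP h; apply: subsetUr. Qed.
Let dis : [disjoint iset I & iset J].
Proof. by have [] := adjP h. Qed.

Lemma adj_split n (x : gsum (iset L) C n) :
  x = tr (iset I) (iset L) n (tr (iset L) (iset I) n x)
    + tr (iset J) (iset L) n (tr (iset L) (iset J) n x).
Proof. by move: x; have [-> _ _] := adjP h => x; apply: tr_split. Qed.

Lemma adj_blk A (m n : int) (e : m = n + 1) x :
  blk A (iset L) e x = blk A (iset I) e (tr _ _ m x)
                         + blk A (iset J) e (tr _ _ m x).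
Proof. by move: x; have [-> _ _] := adjP h => x; apply: blk_split. Qed.

Lemma adj_tri (m n : int) (e : m = n + 1) x : blk (iset J) (iset I) e x = 0.
Proof. by have [_ _ ?] := adjP h; apply: blk_tri. Qed.

Lemma chain_incl :
  @is_chain_map R (cbraid I) (cbraid L) (tr (iset I) (iset L)).
Proof.
move=> m n e x /=; apply/esym/(etrans (adj_split _)).
rewrite (tr_blk D e _ subI) (tr_blk D e _ subJ) !(blk_tr D e _ _ subI) adj_tri.
by rewrite linear0 addr0.
Qed.

Lemma chain_proj :
  @is_chain_map R (cbraid L) (cbraid J) (tr (iset L) (iset J)).
Proof. by move=> m n e x /=; rewrite tr_blk // adj_blk adj_tri add0r. Qed.

Lemma bconn_anti (l m n : int) (e1 : l = m + 1) (e2 : m = n + 1) x :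
  blk (iset I) (iset I) e2 (blk (iset I) (iset J) e1 x) =
  - blk (iset I) (iset J) e2 (blk (iset J) (iset J) e1 x).
Proof.
apply/eqP; rewrite -addr_eq0; apply/eqP.
have /= := blk_sq D e1 e2 x subI subJ.
by rewrite adj_blk !tr_blk.
Qed.

Section Conn.
Variables (m n : int) (e : m = n + 1).
Fact bconn_ker x :
  cdiff (cbraid J) (predK m) x = 0 ->
  cdiff (cbraid I) (predK n) (blk (iset I) (iset J) e x) = 0.
Proof.
move=> dx; have dx' : blk (iset J) (iset J) e x = 0 := cdiff_ker dx e.
by apply: etrans (bconn_anti _ _ _) _; rewrite dx' linear0 oppr0.
Qed.

Fact bconn_bdry (y : cmod (cbraid J) (m + 1)) :
  exists y', blk (iset I) (iset J) e (cdiff (cbraid J) (erefl (m + 1)) y)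
           = cdiff (cbraid I) (erefl (n + 1)) y'.
Proof.
subst m; exists (- blk (iset I) (iset J) (erefl (n + 1 + 1)) y).
by rewrite /= linearN bconn_anti opprK.
Qed.

(* The connecting homomorphism of 0 -> C(I) -> C(IJ) -> C(J) -> 0: a cycle x of
   C(J) lifts to (0, x) in C(IJ), whose boundary is Delta(I, J) x in C(I), so it
   is induced by the off-diagonal block Delta(I, J). *)
Definition hconn : {linear ghomology (cbraid J) m -> ghomology (cbraid I) n} :=
  hmap bconn_ker bconn_bdry.
End Conn.
End Adjacent.

Definition hbraid_data : braid_data R P := @BraidData R d P
  (fun I => ghomology (cbraid I))
  (fun I J L h => ghomology_map (chain_incl h))
  (fun I J L h => ghomology_map (chain_proj h))
  (fun I J L h => hconn h).
End HomologyBraid.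

Lemma hclass_eq0 (R : pzRingType) (U V W : lmodType R) (g : {linear U -> V})
    (f : {linear V -> W}) (x : ker f) :
  hclass g x = 0 <-> exists z, val x = g z.
Proof.
rewrite -[0](linear0 (hclass g (f := f))) hclass_eq.
have v0 : val (0 : ker f) = 0 by exact: linear0.
by rewrite v0 subr0.
Qed.

Section HomClass.
Variables (R : pzRingType) (C : complex R).

Lemma hcl_surj n (u : ghomology C n) : exists x, u = hcl x.
Proof. exact: hclass_surj. Qed.

Lemma hcl_eq n (x y : ker (cdiff C (predK n))) :
  hcl x = hcl y <-> exists z, val x - val y = cdiff C (erefl (n + 1)) z.
Proof. exact: hclass_eq. Qed.

Lemma hcl_eq0 n (x : ker (cdiff C (predK n))) :
  hcl x = 0 <-> exists z, val x = cdiff C (erefl (n + 1)) z.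
Proof. exact: hclass_eq0. Qed.

Lemma ghomology_mapE C' (f : ghom0 (cmod C) (cmod C')) (hf : is_chain_map f) n x :
  ghomology_map hf n (hcl x) = hcl (kerm (@chain_map_ker _ _ _ _ hf n) x).
Proof. exact: hmapE. Qed.
End HomClass.

Lemma ker_cdiff (R : pzRingType) (C : complex R) (m n : int) (e : m = n + 1)
    (x : cmod C m) : cdiff C e x = 0 -> in_ker (cdiff C (predK m)) x.
Proof.
move=> dx; have nm : n = m - 1 by rewrite e addrK.
by subst n; apply/eqP; rewrite (eq_irrelevance (predK m) e).
Qed.

Section HomologyIsBraid.
Variables (R : pzRingType) (d : Order.disp_t) (P : finPOrderType d).
Variables (C : P -> gmod R) (D : boundary C).
Local Notation blk := (block1 (bmat D)).
Local Notation tr := (@gtransfer R d P C).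
Local Notation G := (hbraid_data D).

Lemma val_kerm (V W V' W' : lmodType R)
   (f : {linear V -> W}) (f' : {linear V' -> W'}) (k : {linear V -> V'})
   (kZ : forall x, f x = 0 -> f' (k x) = 0) (x : ker f) :
  val (kerm kZ x) = k (val x).
Proof. by []. Qed.
Lemma val_Ker (V W : lmodType R) (f : {linear V -> W}) x (h : in_ker f x) :
  val (Ker h) = x.
Proof. by []. Qed.
Lemma cdiffE I (m n : int) (e : m = n + 1) x :
  cdiff (cbraid D I) e x = blk (iset I) (iset I) e x.
Proof. by []. Qed.
Let hE := (val_kerm, val_Ker, cdiffE).

Section Adjacent.
Variables (I J L : interval P) (h : adj I J L).

Let subI : iset I \subset iset L.
Proof. by have [-> _ _] := adjP h; apply: subsetUl. Qed.
Let subJ : iset J \subset iset L.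
Proof. by have [-> _ _] := adjP h; apply: subsetUr. Qed.
Let dis : [disjoint iset I & iset J].
Proof. by have [] := adjP h. Qed.

Let trtrI n x : tr (iset L) (iset I) n (tr (iset I) (iset L) n x) = x.
Proof. by rewrite trtr ?trid // setIid. Qed.
Let trtrJ n x : tr (iset L) (iset J) n (tr (iset J) (iset L) n x) = x.
Proof. by rewrite trtr ?trid // setIid. Qed.
Let trtrIJ n x : tr (iset L) (iset J) n (tr (iset I) (iset L) n x) = 0.
Proof.
by rewrite trtr ?tr0 //; apply: subset_trans (subsetIl _ _) subI.
Qed.
Let trtrJI n x : tr (iset L) (iset I) n (tr (iset J) (iset L) n x) = 0.
Proof.
rewrite trtr ?tr0 //; first by rewrite disjoint_sym.
exact: subset_trans (subsetIl _ _) subJ.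
Qed.

Lemma blk_inI (m n : int) (e : m = n + 1) x :
  blk (iset L) (iset L) e (tr (iset I) (iset L) m x) =
  tr (iset I) (iset L) n (blk (iset I) (iset I) e x).
Proof. exact: (esym (chain_incl (D := D) h e x)). Qed.

Lemma blk_inJ (m n : int) (e : m = n + 1) x :
  blk (iset L) (iset L) e (tr (iset J) (iset L) m x) =
  tr (iset I) (iset L) n (blk (iset I) (iset J) e x)
  + tr (iset J) (iset L) n (blk (iset J) (iset J) e x).
Proof.
apply: (etrans (adj_split h _)).
rewrite (tr_blk D e _ subI) (tr_blk D e _ subJ).
by rewrite !(blk_tr D e _ _ subJ).
Qed.

Lemma prI_blk (m n : int) (e : m = n + 1) x :
  tr (iset L) (iset I) n (blk (iset L) (iset L) e x) =
  blk (iset I) (iset I) e (tr (iset L) (iset I) m x)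
  + blk (iset I) (iset J) e (tr (iset L) (iset J) m x).
Proof. by rewrite tr_blk // (adj_blk D h). Qed.

Lemma prJ_blk (m n : int) (e : m = n + 1) x :
  tr (iset L) (iset J) n (blk (iset L) (iset L) e x) =
  blk (iset J) (iset J) e (tr (iset L) (iset J) m x).
Proof. exact: (chain_proj (D := D) h e x). Qed.

Lemma biE n x : bi G h n (hcl x) = hcl (kerm (@chain_map_ker _ _ _ _ (chain_incl h) n) x).
Proof. exact: hmapE. Qed.
Lemma bpE n x : bp G h n (hcl x) = hcl (kerm (@chain_map_ker _ _ _ _ (chain_proj h) n) x).
Proof. exact: hmapE. Qed.
Lemma bdE (m n : int) (e : m = n + 1) x : bd G h e (hcl x) = hcl (kerm (@bconn_ker _ _ _ _ D _ _ _ h m n e) x).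
Proof. exact: hmapE. Qed.

Lemma h_exact_mid n : exact (bi G h n) (bp G h n).
Proof.
move=> y; have [x ->{y}] := hcl_surj y.
split=> [|[y]]; last first.
  have [{}y ->] := hcl_surj y; move=> ->; rewrite ?(biE, bpE, bdE); apply/hcl_eq0.
  by exists 0; rewrite linear0 hE trtrIJ.
rewrite ?(biE, bpE, bdE) => /hcl_eq0[z]; rewrite !hE => xz.
pose w := val x - blk (iset L) (iset L) (erefl (n + 1)) (tr (iset J) (iset L) _ z).
have wJ : tr (iset L) (iset J) n w = 0.
  by rewrite linearB prJ_blk trtrJ xz subrr.
have wI : w = tr (iset I) (iset L) n (tr (iset L) (iset I) n w).
  by rewrite {1}[w](adj_split h) wJ linear0 addr0.
have dw : blk (iset L) (iset L) (predK n) w = 0.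
  rewrite linearB blk_sq_diag subr0; exact: kerP x.
have dI : cdiff (cbraid D I) (predK n) (tr (iset L) (iset I) n w) = 0.
  have := congr1 (tr (iset L) (iset I) _) dw.
  by rewrite prI_blk wJ !linear0 addr0.
have dI' : in_ker (cdiff (cbraid D I) (predK n)) (tr (iset L) (iset I) n w).
  exact/eqP.
exists (hcl (Ker dI')); rewrite ?(biE, bpE, bdE); apply/hcl_eq.
exists (tr (iset J) (iset L) _ z); rewrite !hE -wI /w opprB addrC subrK.
by [].
Qed.

Lemma h_exact_quo (m n : int) (e : m = n + 1) : exact (bp G h m) (bd G h e).
Proof.
subst m => y; have [x ->{y}] := hcl_surj y.
have dx : blk (iset J) (iset J) (erefl (n + 1)) (val x) = 0 := hcl_ker x _.
split=> [|[y]]; last first.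
  have [{}y ->] := hcl_surj y; rewrite ?(biE, bpE, bdE) => /hcl_eq[u]; rewrite !hE => xy.
  have dy : blk (iset L) (iset L) (erefl (n + 1)) (val y) = 0 := hcl_ker y _.
  have := prI_blk (erefl (n + 1)) (val y); rewrite dy linear0.
  move/eqP; rewrite eq_sym addrC addr_eq0 => /eqP dIJy.
  apply/hcl_eq0; exists (- tr (iset L) (iset I) _ (val y)
     - blk (iset I) (iset J) (erefl (n + 1 + 1)) u).
  rewrite !hE -[val x](subrK (tr (iset L) (iset J) _ (val y))) xy.
  rewrite linearD dIJy linearB !linearN.
  by rewrite (bconn_anti D h) opprK addrC.
rewrite ?(biE, bpE, bdE) => /hcl_eq0[w]; rewrite !hE => xw.
pose z := tr (iset J) (iset L) _ (val x) - tr (iset I) (iset L) _ w.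
have dz : blk (iset L) (iset L) (erefl (n + 1)) z = 0.
  rewrite linearB blk_inI blk_inJ dx xw linear0 addr0.
  by rewrite subrr.
have dz' : in_ker (cdiff (cbraid D L) (predK (n + 1))) z.
  exact: (ker_cdiff (C := cbraid D L) dz).
exists (hcl (Ker dz')); rewrite ?(biE, bpE, bdE); congr hcl; apply: val_inj.
by rewrite !hE linearB trtrJ trtrIJ subr0.
Qed.

Lemma h_exact_sub (m n : int) (e : m = n + 1) : exact (bd G h e) (bi G h n).
Proof.
subst m => y; have [x ->{y}] := hcl_surj y.
split=> [|[y]]; last first.
  have [{}y ->] := hcl_surj y; move=> ->; rewrite ?(biE, bpE, bdE).
  have dy : blk (iset J) (iset J) (erefl (n + 1)) (val y) = 0 := hcl_ker y _.
  apply/hcl_eq0; exists (tr (iset J) (iset L) _ (val y)).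
  by rewrite !hE blk_inJ dy linear0 addr0.
rewrite ?(biE, bpE, bdE) => /hcl_eq0[w]; rewrite !hE => xw.
have dJ : blk (iset J) (iset J) (erefl (n + 1)) (tr (iset L) (iset J) _ w) = 0.
  by rewrite -prJ_blk -xw trtrIJ.
have dJ' : in_ker (cdiff (cbraid D J) (predK (n + 1))) (tr (iset L) (iset J) _ w).
  exact: (ker_cdiff (C := cbraid D J) dJ).
exists (hcl (Ker dJ')); rewrite ?(biE, bpE, bdE); apply/hcl_eq.
exists (tr (iset L) (iset I) _ w).
by rewrite !hE -[val x]trtrI xw prI_blk addrK.
Qed.
End Adjacent.

Lemma hbraid_is_braid : is_braid G.
Proof.
split=> [I J L h m n e|I J L h h' _ n x|I J K IJ JK L _ hIJ hJK hI_JK hIJ_K].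
- by split; [apply: h_exact_mid|apply: h_exact_quo|apply: h_exact_sub].
- have [{}x ->] := hcl_surj x; rewrite ?(biE, bpE, bdE); congr hcl.
  apply: val_inj; rewrite !hE trtr ?trid //.
  by have [-> _ _] := adjP h; rewrite setIid subsetUl.
have [IJE IdJ _] := adjP hIJ; have [JKE JdK _] := adjP hJK.
have [LE IdJK _] := adjP hI_JK; have [LE' IJdK _] := adjP hIJ_K.
have subIJ : iset IJ \subset iset L by rewrite LE' subsetUl.
have subJK : iset JK \subset iset L by rewrite LE subsetUr.
have subI : iset I \subset iset IJ by rewrite IJE subsetUl.
have subJ : iset J \subset iset JK by rewrite JKE subsetUl.
have subJ' : iset J \subset iset IJ by rewrite IJE subsetUr.
have subK : iset K \subset iset JK by rewrite JKE subsetUr.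
split.
  move=> n x; have [{}x ->] := hcl_surj x; rewrite ?(biE, bpE, bdE); congr hcl.
  apply: val_inj; rewrite !hE trtr //.
  by apply: subset_trans (subsetIl _ _) subI.
split.
  move=> n x; have [{}x ->] := hcl_surj x; rewrite ?(biE, bpE, bdE); congr hcl.
  apply: val_inj; rewrite !hE trtr //.
  by apply: subset_trans (subsetIr _ _) subK.
split.
  move=> n x; have [{}x ->] := hcl_surj x; rewrite ?(biE, bpE, bdE); congr hcl.
  apply: val_inj; rewrite !hE !trtr //.
    apply/subsetP => p; rewrite inE IJE inE => /andP[/orP[pI|//] pJK].
    by rewrite (disjointFr IdJK pI) in pJK.
  by apply: subset_trans (subsetIl _ _) subIJ.
split.
  move=> m n e x; have [{}x ->] := hcl_surj x; rewrite ?(biE, bpE, bdE); congr hcl.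
  by apply: val_inj; rewrite !hE blk_tr.
split.
  move=> m n e x; have [{}x ->] := hcl_surj x; rewrite ?(biE, bpE, bdE); congr hcl.
  by apply: val_inj; rewrite !hE tr_blk.
move=> m n e x; have [{}x ->] := hcl_surj x; rewrite ?(biE, bpE, bdE).
apply/hcl_eq; subst m.
have dx : blk (iset JK) (iset JK) (erefl (n + 1)) (val x) = 0 := hcl_ker x _.
exists (tr (iset JK) (iset IJ) _ (val x)); rewrite !hE.
have -> : tr (iset JK) (iset IJ) _ (val x) =
    tr (iset J) (iset IJ) _ (tr (iset JK) (iset J) _ (val x)).
  rewrite trtr //; apply/subsetP => p; rewrite inE IJE inE => /andP[pJK /orP[pI|//]].
  by rewrite (disjointFr IdJK pI) in pJK.
rewrite (blk_inJ hIJ) (adj_blk D hJK).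
rewrite [X in _ - X](adj_split hIJ) (tr_blk D _ _ subI) (tr_blk D _ _ subJ') linearD.
have := prI_blk hJK (erefl (n + 1)) (val x).
rewrite dx linear0 => /esym/eqP; rewrite addr_eq0 => /eqP ->.
by rewrite opprD addrA addrK linearN.
Qed.
End HomologyIsBraid.

Section ConnectionTransition.
Variables (R : pzRingType) (d : Order.disp_t) (P : finPOrderType d).
Implicit Types (C : P -> gmod R) (G : braid R P).

Definition hbraid C (D : boundary C) : braid R P :=
  Braid (hbraid_is_braid D).

Definition is_connection C (D : boundary C) G : Prop :=
  (exists Phi : bhom (hbraid D) G, is_braid_iso Phi) /\
  (forall p, giso (C p) (bmod G (interval1 p))).

Section Transition.
Variables (C C' : P -> gmod R) (D : boundary C) (D' : boundary C').
Variable T : mat0 C C'.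

Definition is_chain_family : Prop := forall I : interval P,
  @is_chain_map R (cbraid D I) (cbraid D' I) (block0 T I I).

Definition commutes_with_ip : Prop :=
  forall I J L : interval P, adj I J L ->
  (forall n x, block0 T L L n (gtransfer C I L n x)
             = gtransfer C' I L n (block0 T I I n x)) /\
  (forall n x, block0 T J J n (gtransfer C L J n x)
             = gtransfer C' L J n (block0 T L L n x)).

(* T_*(I). *)
Definition tstar (hT : is_chain_family) (I : interval P) :
    ghom0 (ghomology (cbraid D I)) (ghomology (cbraid D' I)) :=
  ghomology_map (hT I).

Definition covers (hT : is_chain_family) G G' (theta : bhom G G')
    (Phi : bhom (hbraid D) G) (Phi' : bhom (hbraid D') G') : Prop :=
  forall (I : interval P) n (x : bmod (hbraid D) I n),
    Phi' I n (tstar hT I n x) = theta I n (Phi I n x).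

(* Transition matrices are only defined between connection matrices, so this is
   part of the predicate. *)
Definition is_transition G G' : Prop :=
  [/\ is_connection D G, is_connection D' G', commutes_with_ip
    & exists (hT : is_chain_family) (theta : bhom G G')
        (Phi : bhom (hbraid D) G) (Phi' : bhom (hbraid D') G'),
        [/\ is_braid_iso theta, is_braid_iso Phi, is_braid_iso Phi'
          & covers hT theta Phi Phi']].

(* The last clause is the matrix identity Delta' T = T Delta. *)
Definition is_alg_transition : Prop :=
  [/\ upper0 T,
      forall p n, bijective (block0 T [set p] [set p] n)
    & forall p q (m n : int) (e : m = n + 1) x,
        \sum_r bmat D' p r e (T r q m x) = \sum_r T p r n (bmat D r q e x)].
End Transition.
End ConnectionTransition.

(* Main.v *)
From HB Require Import structures.
From mathcomp Require Import all_boot all_order all_algebra.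
From mathcomp Require Import boolp.
Require Import Defs.

Set Implicit Arguments.
Unset Strict Implicit.
Unset Printing Implicit Defensive.

Import Order.TTheory GRing.Theory.
Local Open Scope ring_scope.

(* A triangular matrix with invertible diagonal is invertible on every index set
   (peel off a minimal index), so each T(I) is an isomorphism of complexes and
   T_*(I) is bijective.  Triangularity also makes T commute with the inclusions
   and projections; for the connecting maps, the (I, J) block of
   Delta' T = T Delta shows that T(I) Delta(I,J) and Delta'(I,J) T(J) differ on
   cycles by the boundary Delta'(I) T(I,J).  Thus T_* is an isomorphism of
   braids, and so is Phi o T_*^-1. *)

(** * Linear bijections and graded isomorphisms *)

Section LinearBijections.
Variable R : pzRingType.

Lemma inj_surj_bij (X Y : Type) (f : X -> Y) :
  injective f -> (forall y, exists x, f x = y) -> bijective f.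
Proof.
move=> f_inj f_surj; have [g fg] := choice f_surj.
by exists g => // x; apply: f_inj.
Qed.

Lemma bij_surj (X Y : Type) (f : X -> Y) :
  bijective f -> forall y, exists x, f x = y.
Proof. by case=> g _ fg y; exists (g y). Qed.

Lemma linear_inj (V W : lmodType R) (f : {linear V -> W}) :
  (forall x, f x = 0 -> x = 0) -> injective f.
Proof.
move=> f0 x y fxy; apply/eqP; rewrite -subr_eq0; apply/eqP/f0.
by rewrite linearB fxy subrr.
Qed.

(** [bijective] provides a bare inverse function; graded maps need one with a linear structure,
    which linearity of [f] and the two cancellation laws supply. *)
Lemma linear_bij_inv (V W : lmodType R) (f : {linear V -> W}) :
  bijective f -> exists g : {linear W -> V}, cancel f g /\ cancel g f.
Proof.
case=> g fK gK.
pose gL := GRing.isLinear.Build R W V _ g (can2_linear fK gK).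
pose g' : {linear W -> V} := HB.pack g gL.
by exists g'.
Qed.

Lemma giso_sym (A B : gmod R) : giso A B -> giso B A.
Proof.
(* [cid] turns the existence of a linear inverse in each degree into a chosen family. *)
case=> f f_bij; have /= inv n := cid (linear_bij_inv (f_bij n)).
exists (fun n => sval (inv n)) => n.
by case: (inv n) => g [fK gK]; exists (f n).
Qed.

Lemma giso_trans (A B C : gmod R) : giso A B -> giso B C -> giso A C.
Proof.
case=> f f_bij [g g_bij]; exists (gcomp g f) => n.
exact: (bij_comp (g_bij n) (f_bij n)).
Qed.
End LinearBijections.

(** * Homology of isomorphic complexes *)

Section ChainIso.
Variables (R : pzRingType) (C C' : complex R).
Variables (f : ghom0 (cmod C) (cmod C')) (hf : is_chain_map f).
Hypothesis f_bij : forall n, bijective (f n).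

(** Besides degree [n], bijectivity of [f] enters in degree [n + 1], to lift a bounding chain, and
    in degree [n - 1], to see that the preimage of a cycle is a cycle. *)
Lemma ghomology_map_bij n : bijective (ghomology_map hf n).
Proof.
apply: inj_surj_bij.
  apply: linear_inj => u; have [x ->{u}] := hcl_surj u.
  rewrite ghomology_mapE => /hcl_eq0[z' /= fx]; apply/hcl_eq0.
  have [z zz'] := bij_surj (f_bij (n + 1)) z'; exists z.
  by apply: (bij_inj (f_bij n)); rewrite hf zz'.
move=> u; have [y ->{u}] := hcl_surj u.
have [x xy] := bij_surj (f_bij n) (val y).
have dx : in_ker (cdiff C (predK n)) x.
  apply/eqP/(bij_inj (f_bij (n - 1))).
  by rewrite hf xy linear0; apply: kerP.
exists (hcl (Ker dx)); rewrite ghomology_mapE; congr hcl.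
exact: val_inj.
Qed.
End ChainIso.

(** * Block triangular matrices of linear maps *)

Section TriangularBlocks.
Variables (R : pzRingType) (d : Order.disp_t) (P : finPOrderType d).
Variables (C C' : P -> gmod R) (T : mat0 C C').
Implicit Types A B I J L : {set P}.
Local Notation tr := (@gtransfer R d P C).
Local Notation tr' := (@gtransfer R d P C').
Local Notation Tb := (block0 T).

Lemma coord_block0 A B n (x : gsum B C n) p :
  coord (Tb A B n x) p =
    if p \in A then \sum_(q in B) T p q n (coord x q) else 0.
Proof. exact: (coord_block (fun p q => T p q n)). Qed.

Lemma tr_block0 A B B' n x : B \subset B' ->
  tr' B' B n (Tb B' A n x) = Tb B A n x.
Proof.
move=> /subsetP sub; apply: coordP => p pB.
by rewrite coord_tr !coord_block0 pB sub.
Qed.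

Lemma block0_tr A A' B n x : A \subset A' ->
  Tb B A' n (tr A A' n x) = Tb B A n x.
Proof.
move=> /subsetP sub; apply: coordP => p pB; rewrite !coord_block0 pB.
rewrite [RHS]big_mkcond [LHS]big_mkcond; apply: eq_bigr => q _.
rewrite coord_tr; case: (boolP (q \in A)) => qA; first by rewrite sub.
by rewrite (coord_out x qA) if_same linear0 if_same.
Qed.

Lemma block0_split B I J n x : [disjoint I & J] ->
  Tb B (I :|: J) n x = Tb B I n (tr _ I n x) + Tb B J n (tr _ J n x).
Proof.
move=> dis; rewrite {1}[x](tr_split _ dis) linearD.
by congr (_ + _); apply: block0_tr; rewrite ?subsetUl ?subsetUr.
Qed.

Hypothesis T_upper : upper0 T.

Lemma block0_tri I J n x : [disjoint I & J] ->
  (forall p q, p \in I -> q \in J -> (q < p)%O = false) ->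
  Tb J I n x = 0.
Proof.
move=> dis ord; apply: coordP => p pJ; rewrite coord_block0 pJ coord0.
rewrite big1 // => q qI; apply/eqP; apply/negPn/negP => /T_upper[pq|].
  by move: pJ; rewrite pq (disjointFr dis qI).
by rewrite ord.
Qed.

(** Back substitution: the [J] row involves only the [J] component, which is found first and then
    moved to the right-hand side of the [I] row. *)
Lemma block0_bij_setU I J n : [disjoint I & J] ->
  (forall p q, p \in I -> q \in J -> (q < p)%O = false) ->
  bijective (Tb I I n) -> bijective (Tb J J n) ->
  bijective (Tb (I :|: J) (I :|: J) n).
Proof.
move=> dis ord bijI bijJ.
have rowI x : tr' _ I n (Tb (I :|: J) (I :|: J) n x) =
    Tb I I n (tr _ I n x) + Tb I J n (tr _ J n x).
  by rewrite tr_block0 ?subsetUl // block0_split.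
have rowJ x : tr' _ J n (Tb (I :|: J) (I :|: J) n x) = Tb J J n (tr _ J n x).
  by rewrite tr_block0 ?subsetUr // block0_split // (block0_tri _ dis ord) add0r.
apply: inj_surj_bij.
  apply: linear_inj => x Tx.
  have xJ : tr _ J n x = 0.
    by apply: (bij_inj bijJ); rewrite -rowJ Tx !linear0.
  have xI : tr _ I n x = 0.
    (* Since the [J] part of [x] vanishes, the off-diagonal term can be added for free, which
       completes the [I] row of [T x = 0]. *)
    apply: (bij_inj bijI); rewrite -[LHS]addr0 -(linear0 (Tb I J n)) -xJ -rowI.
    by rewrite Tx !linear0.
  by rewrite [x](tr_split _ dis) xI xJ !linear0 addr0.
move=> y.
have [xJ TxJ] := bij_surj bijJ (tr' _ J n y).
have [xI TxI] := bij_surj bijI (tr' _ I n y - Tb I J n xJ).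
pose x := tr I (I :|: J) n xI + tr J (I :|: J) n xJ.
have eI : tr _ I n x = xI.
  rewrite linearD !trtr ?trid ?tr0 ?addr0 ?setIid ?subsetUl ?subsetIl //.
    by rewrite disjoint_sym.
  exact: subset_trans (subsetIl _ _) (subsetUr _ _).
have eJ : tr _ J n x = xJ.
  rewrite linearD !trtr ?trid ?tr0 ?add0r ?setIid ?subsetUr //.
  exact: subset_trans (subsetIl _ _) (subsetUl _ _).
exists x; rewrite [LHS](tr_split _ dis) [RHS](tr_split _ dis).
by rewrite rowI rowJ eI eJ TxI TxJ subrK.
Qed.

Hypothesis T_diag : forall p n, bijective (Tb [set p] [set p] n).

Lemma block0_bij A n : bijective (Tb A A n).
Proof.
have [k] := ubnP #|A|; elim: k A => // k IHk A Ak.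
have [->|[p0 p0A]] := set_0Vmem A.
  by exists (fun=> 0) => x; apply: coordP => p; rewrite inE.
(* Counting strict predecessors is strictly monotone, since [q < p] puts [q] below [p] but not below
   itself. So a minimizer of [below] on [A] is a minimal element of [A], and peeling it off leaves a
   block triangular matrix. *)
pose below (p : P) := #|[set q | (q < p)%O]|.
case: (arg_minnP below p0A) => p pA p_min.
have {}pA : p \in A := pA.
rewrite -(setD1K pA); apply: block0_bij_setU => //.
- by rewrite disjoints1 !inE eqxx.
- move=> _ q /set1P -> /setD1P[_ qA]; apply/negP => qp.
  have := p_min q qA; rewrite leqNgt => /negP; apply; apply: proper_card.
  apply/properP; split; last by exists q; rewrite !inE ?qp ?ltxx.
  by apply/subsetP => r; rewrite !inE => /lt_trans; apply.
by apply: IHk; move: Ak; rewrite (cardsD1 p A) pA.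
Qed.
End TriangularBlocks.

(** * Direct sums over one index *)

Section SingleComponent.
Variables (R : pzRingType) (d : Order.disp_t) (P : finPOrderType d).

Lemma coord1_bij (C : P -> gmod R) p n :
  bijective (fun x : gsum [set p] C n => coord x p).
Proof.
apply: inj_surj_bij => [x y xy|v]; first by apply: coordP => q /set1P ->.
(* The preimage is the dependent family with value [v] at [p] and 0 elsewhere. *)
exists [ffun q => dfwith (fun q => 0 : C q n) v (val q)].
by rewrite (coord_ffun (dfwith (fun q => 0 : C q n) v)) ?set11 // dfwith_in.
Qed.

(** Links two readings of the diagonal: [is_alg_transition] speaks of the block on [[set p]],
    [is_connection] of [C p] itself. *)
Lemma giso_gsum1 (C : P -> gmod R) p : giso (gsum [set p] C) (C p).
Proof.
pose c n (x : gsum [set p] C n) := coord x p.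
have cL n : linear (c n) by exact: coord_linear.
pose cl n : {linear gsum [set p] C n -> C p n} :=
  HB.pack (c n) (GRing.isLinear.Build R _ _ _ (c n) (cL n)).
by exists cl => n; apply: coord1_bij.
Qed.
End SingleComponent.

(** * Composition and inversion of braid isomorphisms *)

Section BraidIsomorphisms.
Variables (R : pzRingType) (d : Order.disp_t) (P : finPOrderType d).

Lemma bid_iso (G : braid R P) : is_braid_iso (bid G).
Proof. by split=> [I J L h|I n]; [split | exists id]. Qed.

Lemma braid_iso_comp (G G' G'' : braid R P) (theta : bhom G G')
    (theta' : bhom G' G'') :
  is_braid_iso theta -> is_braid_iso theta' ->
  is_braid_iso ((fun I => gcomp (theta' I) (theta I)) : bhom G G'').
Proof.
case=> m b [m' b']; split=> [I J L h|I n]; last first.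
  exact: (bij_comp (b' I n) (b I n)).
have [mi mp md] := m I J L h; have [mi' mp' md'] := m' I J L h.
by split=> *; rewrite /gcomp /= ?(mi, mp, md) ?(mi', mp', md').
Qed.

(** A commuting square still commutes when its two [theta] sides are replaced by their inverses. *)
Lemma braid_iso_inv (G G' : braid R P) (theta : bhom G G') (S : bhom G' G) :
  is_braid_map theta ->
  (forall I n, cancel (theta I n) (S I n) /\ cancel (S I n) (theta I n)) ->
  is_braid_iso S.
Proof.
move=> m tS; have K I n := (tS I n).1; have K' I n := (tS I n).2.
split=> [I J L h|I n]; last by exists (theta I n); [apply: K' | apply: K].
have [mi mp md] := m I J L h.
split=> [n x|n x|m' n e x].
- by rewrite -[RHS](K L n) mi K'.
- by rewrite -[RHS](K J n) mp K'.
- by rewrite -[RHS](K I n) md K'.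
Qed.
End BraidIsomorphisms.

(** * The braid map induced by an algebraic transition matrix *)

Section AlgebraicTransition.
Variables (R : pzRingType) (d : Order.disp_t) (P : finPOrderType d).
Variables (C C' : P -> gmod R) (D : boundary C) (D' : boundary C').
Variable T : mat0 C C'.
Hypothesis hT : is_alg_transition D D' T.
Local Notation tr := (@gtransfer R d P C).
Local Notation tr' := (@gtransfer R d P C').
Local Notation Tb := (block0 T).
Local Notation blk := (block1 (bmat D)).
Local Notation blk' := (block1 (bmat D')).

(* By triangularity, a term of the full matrix product at (p, q) vanishes unless
   its summation index lies between p and q, hence in L. *)
Lemma block0_comm (L : interval P) (A B : {set P}) (m n : int) (e : m = n + 1) x :
  A \subset iset L -> B \subset iset L ->
  blk' A (iset L) e (Tb (iset L) B m x) = Tb A (iset L) n (blk (iset L) B e x).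
Proof.
case: hT => upT _ comT /subsetP AL /subsetP BL.
have notin p q r : p \in A -> q \in B -> r \notin iset L ->
    p = r \/ (p < r)%O -> r = q \/ (r < q)%O -> False.
  move=> /AL pL /BL qL rL [pr|pr] [rq|rq]; move: rL.
  - by rewrite -pr pL.
  - by rewrite -pr pL.
  - by rewrite rq qL.
  - by rewrite (intervalP pL qL pr rq).
apply: coordP => p pA; rewrite coord_blk coord_block0 pA.
under eq_bigr => r rL do rewrite coord_block0 rL linear_sum /=.
under [RHS]eq_bigr => r rL do rewrite coord_blk rL linear_sum /=.
rewrite exchange_big [RHS]exchange_big; apply: eq_bigr => q qB /=.
transitivity (\sum_r bmat D' p r e (T r q m (coord x q))).
  rewrite big_mkcond; apply: eq_bigr => r _; case: ifPn => // rL.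
  apply/esym/eqP/negPn/negP => nz; apply: (notin p q r pA qB rL).
    exact: bmat_upper nz.
  by apply: upT (coord x q) _; apply: contraNneq nz => ->; rewrite linear0.
rewrite comT [RHS]big_mkcond; apply: eq_bigr => r _; case: ifPn => // rL.
apply/eqP/negPn/negP => nz; apply: (notin p q r pA qB rL); first exact: upT nz.
apply: (@bmat_upper _ _ _ _ D r q m n e (coord x q)).
by apply: contraNneq nz => ->; rewrite linear0.
Qed.

Lemma alg_transition_chain_family : is_chain_family D D' T.
Proof. by move=> I m n e x; rewrite /= block0_comm. Qed.

Section Adjacent.
Variables (I J L : interval P) (h : adj I J L).

Let subI : iset I \subset iset L.
Proof. by have [-> _ _] := adjP h; apply: subsetUl. Qed.
Let subJ : iset J \subset iset L.
Proof. by have [-> _ _] := adjP h; apply: subsetUr. Qed.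

Lemma adj_block0 A n x :
  Tb A L n x = Tb A I n (tr L I n x) + Tb A J n (tr L J n x).
Proof. by move: x; have [-> ? _] := adjP h => x; apply: block0_split. Qed.

Lemma adj_block0_tri n x : Tb J I n x = 0.
Proof. by case: hT => upT _ _; have [_ ? ?] := adjP h; apply: block0_tri. Qed.

(** The [J] part of the image is T(J, I) x, which triangularity kills. *)
Lemma block0_incl n x : Tb L L n (tr I L n x) = tr' I L n (Tb I I n x).
Proof.
apply/(etrans (adj_split h _)).
rewrite (tr_block0 T _ subI) (tr_block0 T _ subJ) !(block0_tr T _ _ subI).
by rewrite adj_block0_tri linear0 addr0.
Qed.

Lemma block0_proj n x : Tb J J n (tr L J n x) = tr' L J n (Tb L L n x).
Proof. by rewrite tr_block0 // adj_block0 adj_block0_tri add0r. Qed.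

(** This is the (I, J) block of Delta' T = T Delta over L, both sides expanded along L = IJ. On a
    cycle [x] of C(J) the last term vanishes, so T(I, J) acts as a homotopy for the connecting
    square. *)
Lemma block0_conn (m n : int) (e : m = n + 1) x :
  blk' I I e (Tb I J m x) + blk' I J e (Tb J J m x) =
  Tb I I n (blk I J e x) + Tb I J n (blk J J e x).
Proof.
have := block0_comm e x subI subJ.
by rewrite (adj_blk D' h) adj_block0 !tr_block0 // !tr_blk //.
Qed.
End Adjacent.

Lemma alg_transition_commutes_with_ip : commutes_with_ip T.
Proof.
by move=> I J L h; split=> n x; [apply: (block0_incl h) | apply: (block0_proj h)].
Qed.

Variable cT : is_chain_family D D' T.

Lemma tstarE (I : interval P) n x :
  tstar cT I n (hcl x) = hcl (kerm (@chain_map_ker _ _ _ _ (@cT I) n) x).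
Proof. exact: ghomology_mapE. Qed.

Lemma tstar_bij (I : interval P) n : bijective (tstar cT I n).
Proof.
by case: hT => upT diT _; apply: ghomology_map_bij => k; apply: block0_bij.
Qed.

Lemma tstar_braid_map : is_braid_map (tstar cT : bhom (hbraid D) (hbraid D')).
Proof.
move=> I J L h; split=> [n u|n u|m n e u]; have [x ->{u}] := hcl_surj u.
(* The squares for [i] and [p] already commute on representing cycles. *)
- rewrite biE [in RHS]tstarE /= tstarE biE.
  apply: (congr1 (@hcl _ (cbraid D' L) n)); apply: val_inj.
  exact: (block0_incl h).
- rewrite bpE [in RHS]tstarE /= tstarE bpE.
  apply: (congr1 (@hcl _ (cbraid D' J) n)); apply: val_inj.
  exact: (block0_proj h).
rewrite bdE [in RHS]tstarE /= tstarE bdE.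
apply/(@hcl_eq _ (cbraid D' I)); subst m.
have dx : blk J J (erefl (n + 1)) (val x) = 0 := hcl_ker x _.
(* The two representatives differ by Delta'(I) applied to T(I, J) x. *)
exists (Tb I J _ (val x)).
have := block0_conn h (erefl (n + 1)) (val x).
by rewrite dx linear0 addr0 /= => <-; rewrite addrK.
Qed.
End AlgebraicTransition.

(** * Transport of [Phi] along the inverse of [T_*] *)

Theorem mainTheorem5 (R : pzRingType) (d : Order.disp_t) (P : finPOrderType d)
    (C C' : P -> gmod R) (D : boundary C) (D' : boundary C')
    (G : braid R P) (Phi : bhom (hbraid D) G) (T : mat0 C C')
    (hD : is_connection D G) (hPhi : is_braid_iso Phi)
    (hD' : exists G' : braid R P, is_connection D' G')
    (hT : is_alg_transition D D' T) :
  exists (cT : is_chain_family D D' T)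
    (S : forall I, ghom0 (bmod (hbraid D') I) (bmod (hbraid D) I)),
    (forall I n, cancel (tstar cT I n) (S I n) /\ cancel (S I n) (tstar cT I n)) /\
    let Phi' : bhom (hbraid D') G := fun I => gcomp (Phi I) (S I) in
    [/\ is_braid_iso Phi', covers cT (bid G) Phi Phi' & is_transition D D' T G G].
Proof.
pose cT := alg_transition_chain_family hT.
have inv I n := cid (linear_bij_inv (tstar_bij hT cT I n)).
pose S : bhom (hbraid D') (hbraid D) := fun I n => sval (inv I n).
have SK I n : cancel (tstar cT I n) (S I n) /\ cancel (S I n) (tstar cT I n).
  by rewrite /S; case: (inv I n).
exists cT, S; split=> // Phi'.
have isoPhi' : is_braid_iso Phi'.
  exact: braid_iso_comp (braid_iso_inv (tstar_braid_map hT cT) SK) hPhi.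
have covPhi' : covers cT (bid G) Phi Phi'.
  by move=> I n x; rewrite /Phi' /gcomp /= (SK I n).1.
split=> //; split=> //.
- split=> [|p]; first by exists Phi'.
  (* The isomorphisms run through C'(p), C'({p}), C({p}), C(p), G({p}); the second link inverts the
     diagonal block of [T] at [p]. *)
  have [_ diT _] := hT; apply: giso_trans (hD.2 p).
  apply: giso_trans (giso_gsum1 C p); apply: giso_sym.
  apply: giso_trans (giso_gsum1 C' p).
  by exists (block0 T [set p] [set p]).
- exact: alg_transition_commutes_with_ip hT.
by exists cT, (bid G), Phi, Phi'; split=> //; apply: bid_iso.
Qed.
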